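(* Let $M=\mathbb R^3\setminus B(0,1)$, where $B(0,1)$ is the open unit ball. Let $A$ be a constant such that $\|v\|_{L^6(\mathbb R^3)}\le A\|\nabla v\|_{L^2(\mathbb R^3)}$ for every $v\in C^1_c(\mathbb R^3)$. Then for every $u\in C^1_c(M)$, $$\|u\|_{L^6(M)}\le 2(2+\sqrt2)\,A\,\|\nabla u\|_{L^2(M)}.$$
   Context: Norms and gradients are Euclidean; $C^1_c(M)$ denotes $C^1$ functions with compact support in $M$ (the support may meet the sphere $\partial M$). *)

(* Defs.v *)
From HB Require Import structures.
From mathcomp Require Import all_boot all_order all_algebra.
From mathcomp Require Import all_classical all_reals all_analysis.
Import Order.TTheory GRing.Theory Num.Theory.
Import numFieldNormedType.Exports.

Set Implicit Arguments.
Unset Strict Implicit.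
Unset Printing Implicit Defensive.

Local Open Scope classical_set_scope.
Local Open Scope ring_scope.

Section R3.
Variable R : realType.

Definition pt3 := (R * R * R)%type.

Definition enorm3 (x : pt3) : R :=
  Num.sqrt (x.1.1 ^+ 2 + x.1.2 ^+ 2 + x.2 ^+ 2).

Definition extM : set pt3 := [set x | 1 <= enorm3 x].

Definition e1 : pt3 := (1, 0, 0).
Definition e2 : pt3 := (0, 1, 0).
Definition e3 : pt3 := (0, 0, 1).

Definition gradnorm (f : pt3 -> R) (x : pt3) : R :=
  Num.sqrt ('D_e1 f x ^+ 2 + 'D_e2 f x ^+ 2 + 'D_e3 f x ^+ 2).

Definition C1_on (U : set pt3) (f : pt3 -> R) : Prop :=
  open U /\
  (forall x, U x -> differentiable f x) /\
  (forall x, U x -> {for x, continuous ('D_e1 f)}) /\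
  (forall x, U x -> {for x, continuous ('D_e2 f)}) /\
  (forall x, U x -> {for x, continuous ('D_e3 f)}).

Definition C1c_R3 (v : pt3 -> R) : Prop :=
  C1_on setT v /\ compact (closure [set x | v x != 0]).

(* C^1_c(M): C^1 up to the boundary sphere (i.e. C^1 on an open
   neighbourhood of M), with support in M compact (it may meet the sphere) *)
Definition C1c_M (u : pt3 -> R) : Prop :=
  (exists U : set pt3, extM `<=` U /\ C1_on U u) /\
  compact (closure (extM `&` [set x | u x != 0])).

Definition leb3 := ((@lebesgue_measure R \x @lebesgue_measure R)
                     \x @lebesgue_measure R)%E.

Definition Lp_on (D : set pt3) (p : R) (f : pt3 -> R) : \bar R :=
  ((\int[leb3]_(x in D) (`|f x| `^ p)%:E) `^ p^-1)%E.

End R3.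

(* Main.v *)
(** No extension operator is used: an explicit inequality on [M] is compared with
    a lower bound on [A].

    From every [x] in [M] and for every coordinate direction, one of the two
    half-lines issued from [x] stays in [M], so [|u x|^4] is at most the
    integral of [4 |u|^3 |D_i u|] over the part of the line through [x] lying in
    [M].  The Gagliardo-Nirenberg argument (Loomis-Whitney, then Cauchy-Schwarz)
    thus works inside [M] and gives [||u||_6 <= 4 / sqrt 3 * ||grad u||_2].

    The function [f(x) f(y) f(z)] with [f(t) = (1 - t^2)_+^6] is admissible in
    the hypothesis on [A] and forces [A >= 0.3419], while
    [4 / sqrt 3 <= 2 (2 + sqrt 2) A] holds as soon as [A >= 0.3383]. *)

Require Import Defs.
From HB Require Import structures.
From mathcomp Require Import all_boot all_order all_algebra.
From mathcomp Require Import all_classical all_reals all_analysis.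
From mathcomp Require Import measurable_realfun.
From mathcomp Require Import ring lra.
Import Order.TTheory GRing.Theory Num.Theory.
Import numFieldNormedType.Exports.
Set Implicit Arguments.
Unset Strict Implicit.

Local Open Scope classical_set_scope.
Local Open Scope ring_scope.

(** * Cauchy-Schwarz, measurability and Tonelli's theorem *)

(** The conclusion scales with [A], so an inequality on [M] whose constant does not involve [A] is
    useful only if [A] cannot be too small; testing the hypothesis on one function gives that. The
    margin is about one percent, so both constants must be tracked exactly. With X the integral of
    u^6 and Y_i that of (D_i u)^2 over [M], the argument gives X <= 8 X^(3/4) (Y1 Y2 Y3)^(1/4),
    hence X <= 4096 Y1 Y2 Y3 <= (16/3 (Y1 + Y2 + Y3))^3 by AM-GM, and 4 / sqrt 3 is the square root
    of 16/3. On the whole space, averaging over both half-lines would replace each factor 4 by 2;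
    here one of them may run into the ball. Cancelling X^(3/4) requires X to be finite, which
    compact support provides. *)

Section CauchySchwarz.
Local Open Scope ereal_scope.
Context (d : measure_display) (T : measurableType d) (R : realType).
Variable mu : {measure set T -> \bar R}.
Implicit Types f g : T -> \bar R.

Let integral_sqrt_mul_eq0 f g : measurable_fun setT f -> measurable_fun setT g ->
  (forall x, 0 <= f x) -> \int[mu]_x f x = 0 ->
  \int[mu]_x (f x `^ 2^-1 * g x `^ 2^-1) = 0.
Proof.
move=> mf mg f0 If0.
have /ae_eq_integral_abs f_ae : \int[mu]_x `|f x| = 0.
  by rewrite -[RHS]If0; apply: eq_integral => x _; rewrite gee0_abs.
rewrite (ae_eq_integral (cst 0)) ?integral0//.
  by apply: emeasurable_funM;
    apply: (measurableT_comp (measurable_poweR _)).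
apply: filterS (f_ae measurableT mf) => x /(_ I) /= + _ => ->.
by rewrite poweR0r ?mul0e// gt_eqF// invr_gt0 ltr0n.
Qed.

(** Extended values are allowed because integrals along lines may be infinite, whereas Hölder is
    applied to real functions. Vanishing integrals are settled first, so that an infinite one then
    makes the right-hand side [+oo]; in the remaining case [f] and [g] are finite almost everywhere
    and [r f], [r g] can replace their square roots. *)
Lemma integral_sqrt_mul_le f g :
  measurable_fun setT f -> measurable_fun setT g ->
  (forall x, 0 <= f x) -> (forall x, 0 <= g x) ->
  \int[mu]_x (f x `^ 2^-1 * g x `^ 2^-1)
    <= (\int[mu]_x f x) `^ 2^-1 * (\int[mu]_x g x) `^ 2^-1.
Proof.
move=> mf mg f0 g0.
have half0 : (2^-1 != 0 :> R)%R by rewrite gt_eqF// invr_gt0 ltr0n.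
have If0 : 0 <= \int[mu]_x f x by exact: integral_ge0.
have Ig0 : 0 <= \int[mu]_x g x by exact: integral_ge0.
have [fz|fz] := eqVneq (\int[mu]_x f x) 0.
  by rewrite (integral_sqrt_mul_eq0 mf mg f0 fz) mule_ge0 ?poweR_ge0.
have [gz|gz] := eqVneq (\int[mu]_x g x) 0.
  under eq_integral do rewrite muleC.
  by rewrite (integral_sqrt_mul_eq0 mg mf g0 gz) mule_ge0 ?poweR_ge0.
have [foo|foo] := eqVneq (\int[mu]_x f x) +oo.
  rewrite foo poweRyr// gt0_mulye ?leey// poweR_gt0//.
  by rewrite lt0e gz.
have [goo|goo] := eqVneq (\int[mu]_x g x) +oo.
  rewrite goo poweRyr// gt0_muley ?leey// poweR_gt0//.
  by rewrite lt0e fz.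
have fin h : measurable_fun setT h -> (forall x, 0 <= h x) ->
    \int[mu]_x h x != +oo -> {ae mu, forall x, h x \is a fin_num}.
  move=> mh h0 hoo; have /integrable_ae : mu.-integrable setT h.
    apply/integrableP; split => //; rewrite ltey.
    by under eq_integral do rewrite gee0_abs//.
  by move=> /(_ measurableT); apply: filterS => x; exact.
pose r (h : T -> \bar R) x : R := (fine (h x) `^ 2^-1)%R.
have mr h : measurable_fun setT h -> measurable_fun setT (r h).
  move=> mh; apply: (measurableT_comp (measurable_powR _)).
  exact: measurableT_comp.
have rint h : measurable_fun setT h -> (forall x, 0 <= h x) ->
    \int[mu]_x h x != +oo -> 'N[mu]_2%:E[EFin \o r h] = (\int[mu]_x h x) `^ 2^-1.
  move=> mh h0 hoo; rewrite unlock; congr (_ `^ _).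
  apply: ae_eq_integral => //.
    apply: (measurableT_comp (measurable_poweR _)).
    by apply: measurableT_comp => //; apply/measurable_EFinP; exact: mr.
  apply: filterS (fin h mh h0 hoo) => x hx _ /=.
  rewrite /r (ger0_norm (powR_ge0 _ _)) -powRrM mulVf// powRr1 ?fineK//.
  by apply: fine_ge0.
have := hoelder mu (mr f mf) (mr g mg) (ltr0n _ 2) (ltr0n _ 2).
rewrite rint// rint// => H; apply: le_trans (H _); last by lra.
rewrite Lnorm1 le_eqVlt; apply/orP; left; apply/eqP.
apply: ae_eq_integral => //.
- by apply: emeasurable_funM; apply: (measurableT_comp (measurable_poweR _)).
- apply: measurableT_comp => //; apply/measurable_EFinP.
  by apply: measurable_funM; exact: mr.
- apply: filterS2 (fin f mf f0 foo) (fin g mg g0 goo) => x fx gx _ /=.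
  rewrite ger0_norm ?mulr_ge0 ?powR_ge0// EFinM -!poweR_EFin.
  by rewrite !fineK.
Qed.

End CauchySchwarz.

Section Measurability.
Context (R : realType).
Local Notation pt3 := (pt3 R).

(** Balls of the product norm are boxes, hence measurable for the product sigma-algebra, and those
    with rational centre and radius [n.+1%:R^-1] that lie in [U] form a countable cover of it. *)
Lemma open_measurable_pt3 (U : set pt3) : open U -> measurable U.
Proof.
move=> oU.
pose c (i : rat * rat * rat * nat) : pt3 :=
  (ratr i.1.1.1, ratr i.1.1.2, ratr i.1.2).
pose B i := if pselect (ball (c i) i.2.+1%:R^-1 `<=` U)
            then ball (c i) i.2.+1%:R^-1 else set0.
have -> : U = \bigcup_i B i.
  apply/seteqP; split => [x Ux|x [i _]]; last first.
    by rewrite /B; case: pselect => //= h; exact: h.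
  have /nbhs_ballP[e /= e0 xe] : nbhs x U by exact: open_nbhs_nbhs.
  have [n ne] : exists n : nat, n.+1%:R^-1 < e / 2.
    have [n] := ltr_add_invr (divr_gt0 e0 (ltr0n R 2)).
    by rewrite add0r; exists n.
  have n0 : 0 < n.+1%:R^-1 :> R by rewrite invr_gt0 ltr0n.
  have q y : exists q : rat, ball (ratr q : R) n.+1%:R^-1 (y : R).
    have [|q] := @rat_in_itvoo R (y - n.+1%:R^-1) (y + n.+1%:R^-1).
      by rewrite ltrD2l (lt_trans _ n0)// oppr_lt0.
    rewrite in_itv/= => /andP[h1 h2]; exists q.
    by rewrite /ball/= distrC ltr_distl ltrBlDr h2 -ltrBlDr h1.
  have [[[q1 h1] [q2 h2]] [q3 h3]] := (q x.1.1, q x.1.2, q x.2).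
  have cx : ball (c (q1, q2, q3, n)) n.+1%:R^-1 x by split.
  exists (q1, q2, q3, n) => //.
  rewrite /B; case: pselect => //= -[] y cy; apply: xe.
  apply: (@le_ball _ _ _ (n.+1%:R^-1 + n.+1%:R^-1)).
    by rewrite [leRHS]splitr lerD// ltW.
  by apply: ball_triangle cy; exact: ball_sym.
apply: countable_bigcupT_measurable; first exact: countableP.
move=> i; rewrite /B; case: pselect => /= [_|_]; last exact: measurable0.
have -> : ball (c i) i.2.+1%:R^-1 =
  (ball (c i).1.1 i.2.+1%:R^-1 `*` ball (c i).1.2 i.2.+1%:R^-1)
    `*` ball (c i).2 i.2.+1%:R^-1 by [].
by apply: measurableX; [apply: measurableX|]; exact: measurable_ball.
Qed.

Lemma continuous_measurable_pt3 (U D : set pt3) (f : pt3 -> R) :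
  open U -> measurable D -> D `<=` U ->
  (forall x, U x -> {for x, continuous f}) -> measurable_fun D f.
Proof.
move=> oU mD DU cf; apply: (@measurable_funS _ _ _ _ U) => //.
  exact: open_measurable_pt3.
apply: (measurability _ (RGenOpens.measurableE R)).
move=> _ [_ [a [b ->] <-]]; apply: open_measurable_pt3.
rewrite openE => x [Ux fx]; apply: filterI; first exact: open_nbhs_nbhs.
by apply: (cf x Ux); apply: open_nbhs_nbhs; split => //; exact: interval_open.
Qed.

Lemma extM_sqr (x : pt3) :
  extM x <-> 1 <= x.1.1 ^+ 2 + x.1.2 ^+ 2 + x.2 ^+ 2.
Proof.
rewrite /extM/= /enorm3 -[X in X <= Num.sqrt _]sqrtr1.
by rewrite ler_sqrt// !addr_ge0// sqr_ge0.
Qed.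

Lemma closed_extM : closed (@extM R).
Proof.
pose g (x : pt3) : R := x.1.1 ^+ 2 + x.1.2 ^+ 2 + x.2 ^+ 2.
have -> : @extM R = g @^-1` [set y | 1 <= y].
  by apply/seteqP; split=> x /extM_sqr.
apply: (@closed_comp _ _ g); last exact: closed_ge.
move=> x _; rewrite /g.
have c1 : {for x, continuous (fun x : pt3 => x.1.1)}.
  by apply: (@continuous_comp _ _ _ fst fst); exact: cvg_fst.
have c2 : {for x, continuous (fun x : pt3 => x.1.2)}.
  by apply: (@continuous_comp _ _ _ fst snd); [exact: cvg_fst|exact: cvg_snd].
have c3 : {for x, continuous (fun x : pt3 => x.2)} by exact: cvg_snd.
by apply: cvgD; [apply: cvgD|]; rewrite expr2; apply: cvgM.
Qed.

Lemma measurable_extM : measurable (@extM R).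
Proof.
rewrite -(setCK (@extM R)); apply: measurableC; apply: open_measurable_pt3.
exact/closed_openC/closed_extM.
Qed.

End Measurability.

Section ProductSigmaFinite.
Local Open Scope ereal_scope.
Context (d1 d2 : measure_display) (T1 : measurableType d1)
  (T2 : measurableType d2) (R : realType).
Variables (m1 : {sigma_finite_measure set T1 -> \bar R})
  (m2 : {sigma_finite_measure set T2 -> \bar R}).

(* The canonical sigma-finite structure on [m1 \x m2] is only inferred for
   subprobabilities, hence this alias. *)
Definition sf_prod : set (T1 * T2)%type -> \bar R := m1 \x m2.

HB.instance Definition _ := Measure.copy sf_prod (m1 \x m2).

Let sf_prod_sigma_finite : sigma_finite setT sf_prod.
Proof.
have /sigma_finiteP[F [TF ndF Foo]] := sigma_finiteT m1.
have /sigma_finiteP[G [TG ndG Goo]] := sigma_finiteT m2.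
exists (fun n => F n `*` G n).
  apply/seteqP; split=> [[x y] _|//].
  have [n _ Fx] : (\bigcup_n F n) x by rewrite -TF.
  have [k _ Gy] : (\bigcup_n G n) y by rewrite -TG.
  exists (maxn n k) => //; split => /=.
    by move: x Fx; exact/subsetPset/ndF/leq_maxl.
  by move: y Gy; exact/subsetPset/ndG/leq_maxr.
move=> k; have [mF Fk] := Foo k; have [mG Gk] := Goo k.
split; first exact: measurableX.
have -> : sf_prod (F k `*` G k) = m1 (F k) * m2 (G k).
  exact: product_measure1E.
by rewrite lte_mul_pinfty// ge0_fin_numE.
Qed.

HB.instance Definition _ := Measure_isSigmaFinite.Build _ _ _ sf_prod
  sf_prod_sigma_finite.

End ProductSigmaFinite.

Section Tonelli.
Local Open Scope ereal_scope.
Context (d1 d2 d3 : measure_display) (T1 : measurableType d1)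
  (T2 : measurableType d2) (T3 : measurableType d3) (R : realType).
Variables (m1 : {sigma_finite_measure set T1 -> \bar R})
  (m2 : {sigma_finite_measure set T2 -> \bar R})
  (m3 : {sigma_finite_measure set T3 -> \bar R}).

Variable g : T1 * T2 * T3 -> \bar R.
Hypotheses (mg : measurable_fun setT g) (g0 : forall x, 0 <= g x).

(** The variable to be integrated is moved to the last place, where measurability of partial
    integrals is available; [g2] does the same for the middle variable. *)
Let g1 (y : (T2 * T3) * T1) := g ((y.2, y.1.1), y.1.2).

Let mg1 : measurable_fun setT g1.
Proof.
apply: (measurableT_comp mg); apply: measurable_fun_pair.
  apply: measurable_fun_pair; first exact: measurable_snd.
  exact: (measurableT_comp measurable_fst measurable_fst).
exact: (measurableT_comp measurable_snd measurable_fst).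
Qed.

Let g2 (y : (T1 * T3) * T2) := g ((y.1.1, y.2), y.1.2).

Let mg2 : measurable_fun setT g2.
Proof.
apply: (measurableT_comp mg); apply: measurable_fun_pair.
  apply: measurable_fun_pair; last exact: measurable_snd.
  exact: (measurableT_comp measurable_fst measurable_fst).
exact: (measurableT_comp measurable_snd measurable_fst).
Qed.

Lemma tonelli123 :
  \int[(m1 \x m2) \x m3]_x g x = \int[m1]_x \int[m2]_y \int[m3]_z g ((x, y), z).
Proof.
transitivity (\int[m1 \x m2]_p \int[m3]_z g (p, z)).
  exact: (@fubini_tonelli1 _ _ _ _ _ (sf_prod m1 m2) m3).
rewrite (fubini_tonelli1 (fubini_F m3 g))//.
- exact: measurable_fun_fubini_tonelli_F.
- by move=> x; exact: integral_ge0.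
Qed.

Lemma measurable_int_fst :
  measurable_fun setT (fun p : T2 * T3 => \int[m1]_x g ((x, p.1), p.2)).
Proof. by apply: (measurable_fun_fubini_tonelli_F g1) => // x; exact: g0. Qed.

Lemma measurable_int_snd :
  measurable_fun setT (fun p : T1 * T3 => \int[m2]_y g ((p.1, y), p.2)).
Proof. by apply: (measurable_fun_fubini_tonelli_F g2) => // x; exact: g0. Qed.

Lemma measurable_int_trd :
  measurable_fun setT (fun p : T1 * T2 => \int[m3]_z g (p, z)).
Proof. exact: (measurable_fun_fubini_tonelli_F g). Qed.

Lemma tonelli_fst :
  \int[(m1 \x m2) \x m3]_x g x = \int[m2 \x m3]_p \int[m1]_x g ((x, p.1), p.2).
Proof.
transitivity (\int[m3]_z \int[m1 \x m2]_p g (p, z)).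
  exact: (@fubini_tonelli2 _ _ _ _ _ (sf_prod m1 m2) m3).
rewrite (fubini_tonelli2 _ measurable_int_fst); last first.
  by move=> x; exact: integral_ge0.
apply: eq_integral => z _.
rewrite (fubini_tonelli2 (fun p => g (p, z)))//.
apply: (measurableT_comp mg); apply: measurable_fun_pair.
  exact: measurable_id.
exact: measurable_cst.
Qed.

(** The middle variable cannot be split off from the nested product directly: the integral is fully
    iterated, then the two inner integrations are exchanged. *)
Lemma tonelli_snd :
  \int[(m1 \x m2) \x m3]_x g x = \int[m1 \x m3]_p \int[m2]_y g ((p.1, y), p.2).
Proof.
rewrite tonelli123 (fubini_tonelli1 _ measurable_int_snd); last first.
  by move=> x; exact: integral_ge0.
apply: eq_integral => x _.
rewrite (fubini_tonelli (fun p => g ((x, p.1), p.2)))//.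
apply: (measurableT_comp mg); apply: measurable_fun_pair.
  apply: measurable_fun_pair; first exact: measurable_cst.
  exact: measurable_fst.
exact: measurable_snd.
Qed.

Lemma tonelli_trd :
  \int[(m1 \x m2) \x m3]_x g x = \int[m1 \x m2]_p \int[m3]_z g (p, z).
Proof. exact: (@fubini_tonelli1 _ _ _ _ _ (sf_prod m1 m2) m3). Qed.

End Tonelli.

(** * The Gagliardo-Nirenberg inequality outside the unit ball *)

Section LoomisWhitney.
Local Open Scope ereal_scope.
Context (d1 d2 d3 : measure_display) (T1 : measurableType d1)
  (T2 : measurableType d2) (T3 : measurableType d3) (R : realType).
Variables (m1 : {sigma_finite_measure set T1 -> \bar R})
  (m2 : {sigma_finite_measure set T2 -> \bar R})
  (m3 : {sigma_finite_measure set T3 -> \bar R}).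
Variables (F1 : T2 * T3 -> \bar R) (F2 : T1 * T3 -> \bar R)
  (F3 : T1 * T2 -> \bar R).
Hypotheses (mF1 : measurable_fun setT F1) (mF2 : measurable_fun setT F2)
  (mF3 : measurable_fun setT F3).
Hypotheses (F10 : forall p, 0 <= F1 p) (F20 : forall p, 0 <= F2 p)
  (F30 : forall p, 0 <= F3 p).

(** Cauchy-Schwarz is used once per variable. In [z] the factor [F3] is constant and [F1], [F2]
    become the marginals [G1], [G2]; in [y] the factor [G2] is constant and [F3] becomes [G3]; in
    [x] only [G2] and [G3] remain. *)
Lemma loomis_whitney :
  \int[(m1 \x m2) \x m3]_x
    (F1 (x.1.2, x.2) `^ 2^-1 * F2 (x.1.1, x.2) `^ 2^-1 * F3 x.1 `^ 2^-1)
  <= (\int[m2 \x m3]_p F1 p) `^ 2^-1 * (\int[m1 \x m3]_p F2 p) `^ 2^-1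
     * (\int[m1 \x m2]_p F3 p) `^ 2^-1.
Proof.
have mrt d (T : measurableType d) (h : T -> \bar R) : measurable_fun setT h ->
    measurable_fun setT (fun x => h x `^ 2^-1).
  exact: (measurableT_comp (measurable_poweR _)).
rewrite tonelli123; last 2 first.
- apply: emeasurable_funM; [apply: emeasurable_funM|]; apply: mrt.
  + apply: (measurableT_comp mF1); apply: measurable_fun_pair; last exact: measurable_snd.
    exact: (measurableT_comp measurable_snd measurable_fst).
  + apply: (measurableT_comp mF2); apply: measurable_fun_pair; last exact: measurable_snd.
    exact: (measurableT_comp measurable_fst measurable_fst).
  + exact: (measurableT_comp mF3 measurable_fst).
- by move=> x; rewrite !mule_ge0 ?poweR_ge0.
pose G1 y := \int[m3]_z F1 (y, z); pose G2 x := \int[m3]_z F2 (x, z).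
pose G3 x := \int[m2]_y F3 (x, y).
have mG1 : measurable_fun setT G1 by exact: measurable_fun_fubini_tonelli_F.
have mG2 : measurable_fun setT G2 by exact: measurable_fun_fubini_tonelli_F.
have mG3 : measurable_fun setT G3 by exact: measurable_fun_fubini_tonelli_F.
have G10 y : 0 <= G1 y by exact: integral_ge0.
have G20 x : 0 <= G2 x by exact: integral_ge0.
have G30 x : 0 <= G3 x by exact: integral_ge0.
rewrite [in leRHS]fubini_tonelli1// [in leRHS]fubini_tonelli1//.
rewrite [in leRHS]fubini_tonelli1//.
have step3 x y :
  \int[m3]_z (F1 (y, z) `^ 2^-1 * F2 (x, z) `^ 2^-1 * F3 (x, y) `^ 2^-1)
  <= G1 y `^ 2^-1 * G2 x `^ 2^-1 * F3 (x, y) `^ 2^-1.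
  have mF1y : measurable_fun setT (fun z => F1 (y, z)).
    by apply: (measurableT_comp mF1); exact: measurable_fun_pair.
  have mF2x : measurable_fun setT (fun z => F2 (x, z)).
    by apply: (measurableT_comp mF2); exact: measurable_fun_pair.
  rewrite ge0_integralZr ?poweR_ge0//.
  - by rewrite lee_wpmul2r ?poweR_ge0// integral_sqrt_mul_le.
  - by apply: emeasurable_funM; exact: mrt.
  - by move=> z _; rewrite mule_ge0 ?poweR_ge0.
have step2 x :
  \int[m2]_y \int[m3]_z
     (F1 (y, z) `^ 2^-1 * F2 (x, z) `^ 2^-1 * F3 (x, y) `^ 2^-1)
  <= (\int[m2]_y G1 y) `^ 2^-1 * (G2 x `^ 2^-1 * G3 x `^ 2^-1).
  have mF3x : measurable_fun setT (fun y => F3 (x, y)).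
    by apply: (measurableT_comp mF3); exact: measurable_fun_pair.
  apply: (@le_trans _ _ (\int[m2]_y
      ((G1 y `^ 2^-1 * F3 (x, y) `^ 2^-1) * G2 x `^ 2^-1))).
    apply: ge0_le_integral => //.
    - by move=> y _; apply: integral_ge0 => z _; rewrite !mule_ge0 ?poweR_ge0.
    - have mi : measurable_fun setT (fun p : T2 * T3 =>
         F1 p `^ 2^-1 * F2 (x, p.2) `^ 2^-1 * F3 (x, p.1) `^ 2^-1).
        apply: emeasurable_funM; [apply: emeasurable_funM|]; apply: mrt => //.
          by apply: (measurableT_comp mF2); exact: measurable_fun_pair.
        by apply: (measurableT_comp mF3); exact: measurable_fun_pair.
      apply: (measurable_fun_fubini_tonelli_F _ mi).
      by move=> p; rewrite !mule_ge0 ?poweR_ge0.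
    - apply: emeasurable_funM => //.
      by apply: emeasurable_funM; exact: mrt.
    - move=> y _; apply: le_trans (step3 x y) _.
      by rewrite muleAC.
  rewrite ge0_integralZr ?poweR_ge0//.
  - rewrite [G2 x `^ _ * _]muleC muleA lee_wpmul2r ?poweR_ge0//.
    exact: integral_sqrt_mul_le.
  - by apply: emeasurable_funM; exact: mrt.
  - by move=> z _; rewrite mule_ge0 ?poweR_ge0.
apply: (@le_trans _ _ (\int[m1]_x
   ((\int[m2]_y G1 y) `^ 2^-1 * (G2 x `^ 2^-1 * G3 x `^ 2^-1)))).
  apply: ge0_le_integral => //.
  - move=> x _; apply: integral_ge0 => y _; apply: integral_ge0 => z _.
    by rewrite !mule_ge0 ?poweR_ge0.
  - have mi : measurable_fun setT (fun p : T1 * T2 * T3 =>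
      F1 (p.1.2, p.2) `^ 2^-1 * F2 (p.1.1, p.2) `^ 2^-1 * F3 p.1 `^ 2^-1).
      apply: emeasurable_funM; [apply: emeasurable_funM|]; apply: mrt.
      + apply: (measurableT_comp mF1); apply: measurable_fun_pair; last exact: measurable_snd.
        exact: (measurableT_comp measurable_snd measurable_fst).
      + apply: (measurableT_comp mF2); apply: measurable_fun_pair; last exact: measurable_snd.
        exact: (measurableT_comp measurable_fst measurable_fst).
      + exact: (measurableT_comp mF3 measurable_fst).
    have mi3 := @measurable_int_trd _ _ _ _ _ _ _ m3 _ mi.
    apply: (measurable_fun_fubini_tonelli_F _ (mi3 _)).
      by move=> p; rewrite !mule_ge0 ?poweR_ge0.
    by move=> p; apply: integral_ge0 => z _; rewrite !mule_ge0 ?poweR_ge0.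
  - apply: emeasurable_funM => //.
    by apply: emeasurable_funM; exact: mrt.
  - by move=> x _; exact: step2.
rewrite ge0_integralZl ?poweR_ge0//.
- by rewrite -muleA lee_wpmul2l ?poweR_ge0// integral_sqrt_mul_le.
- by apply: emeasurable_funM; exact: mrt.
- by move=> z _; rewrite mule_ge0 ?poweR_ge0.
Qed.

End LoomisWhitney.

Section Line.
Context (R : realType).
Implicit Types (f : R -> R) (u : pt3 R -> R).

Lemma dist_le_integral_derive f f' (a b : R) : a <= b ->
  (forall t : R, a <= t <= b -> is_derive t 1 f (f' t)) ->
  (forall t : R, a <= t <= b -> {for t, continuous f'}) ->
  (`|f b - f a|%:E <= \int[@lebesgue_measure R]_(t in `[a, b]) `|f' t|%:E)%E.
Proof.
move=> ab df cf'.
have [->|neq] := eqVneq a b.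
  by rewrite subrr normr0 integral_ge0// => t _; rewrite lee_fin.
have {ab}ab : a < b by rewrite lt_neqAle neq.
have cf (t : R) : a <= t <= b -> {for t, continuous f}.
  move=> tab; apply: differentiable_continuous; apply/derivable1_diffP.
  by have [] := df t tab.
have cw : {within `[a, b], continuous f'}.
  apply: continuous_in_subspaceT => t; rewrite inE/= in_itv/=; exact: cf'.
have mf' : measurable_fun `[a, b]%classic (EFin \o f').
  apply/measurable_EFinP.
  apply: subspace_continuous_measurable_fun => //.
rewrite -abse_EFin EFinB -(continuous_FTC2 ab cw); last 2 first.
- split.
  + by move=> t; rewrite in_itv/= => /andP[h1 h2];
      have [] := df t _; rewrite // !ltW.
  + by apply: cvg_at_right_filter; apply: cf; rewrite lexx ltW.
  + by apply: cvg_at_left_filter; apply: cf; rewrite lexx ltW.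
- move=> t; rewrite in_itv/= => /andP[h1 h2].
  by rewrite derive1E; have [] := df t _; rewrite // !ltW.
by apply: le_abse_integral.
Qed.

(** The hypothesis says that [g] is an affine line of direction [e]. The difference quotients
    already agree before the limit, so derivability and the value of the derivative both
    transfer. *)
Let line_quotient u (g : R -> pt3 R) (e : pt3 R) t :
  (forall h s, g (h + s) = h *: e + g s) ->
  (fun h : R => h^-1 *: ((u \o g \o shift t) (h *: (1 : R)) - (u \o g) t))
    = (fun h => h^-1 *: ((u \o shift (g t)) (h *: e) - u (g t))).
Proof.
move=> ge; apply/funext => h /=; congr (_ *: (u _ - _)).
by rewrite /shift /= -ge; congr g; rewrite /GRing.scale /= mulr1.
Qed.

Lemma derive_line u (g : R -> pt3 R) (e : pt3 R) t :
  (forall h s, g (h + s) = h *: e + g s) ->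
  'D_1 (u \o g) t = 'D_e u (g t).
Proof. by move=> ge; rewrite /derive (line_quotient _ _ ge). Qed.

Lemma is_derive_line u (g : R -> pt3 R) (e : pt3 R) t :
  (forall h s, g (h + s) = h *: e + g s) ->
  derivable u (g t) e -> is_derive t 1 (u \o g) ('D_e u (g t)).
Proof.
move=> ge du; split; last exact: derive_line.
by rewrite /derivable (line_quotient _ _ ge).
Qed.

Lemma line_fst (a b c h : R) :
  (h + a, b, c) = h *: e1 R + (a, b, c) :> pt3 R.
Proof.
by rewrite -[RHS]/(h * 1 + a, h * 0 + b, h * 0 + c) mulr1 mulr0 !add0r.
Qed.

Lemma line_snd (a b c h : R) :
  (a, h + b, c) = h *: e2 R + (a, b, c) :> pt3 R.
Proof.
by rewrite -[RHS]/(h * 0 + a, h * 1 + b, h * 0 + c) mulr1 mulr0 !add0r.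
Qed.

Lemma line_trd (a b c h : R) :
  (a, b, h + c) = h *: e3 R + (a, b, c) :> pt3 R.
Proof.
by rewrite -[RHS]/(h * 0 + a, h * 0 + b, h * 1 + c) mulr1 mulr0 !add0r.
Qed.

End Line.

Lemma continuous_pair (T A B : topologicalType) (f : T -> A) (g : T -> B) :
  continuous f -> continuous g -> continuous (fun t => (f t, g t)).
Proof. by move=> cf cg t; apply: (cvg_pair (cf t) (cg t)). Qed.

Section ExteriorGN.
Context (R : realType).
Local Notation pt3 := (pt3 R).
Local Notation leb := (@lebesgue_measure R).
Local Notation M := (@extM R).
Variables (u : pt3 -> R) (U : set pt3).
Hypotheses (MU : M `<=` U) (uC1 : C1_on U u)
  (suppu : compact (closure (M `&` [set x | u x != 0]))).

Let uder x : U x -> differentiable u x.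
Proof. by move: uC1 => [_ [+ _]]; exact. Qed.

Let ucont x : U x -> {for x, continuous u}.
Proof. by move=> Ux; apply: differentiable_continuous; exact: uder. Qed.

Lemma support_bounded : exists2 K, 0 < K & forall x : pt3, M x -> u x != 0 ->
  [/\ `|x.1.1| <= K, `|x.1.2| <= K & `|x.2| <= K].
Proof.
have [K K0 bK] := ex_strict_bound_gt0 (compact_bounded suppu).
exists K => // x Mx ux.
have := bK x (subset_closure (conj Mx ux)).
rewrite /= !prod_normE !gt_max => /andP[/andP[h1 h2] h3].
by split; exact: ltW.
Qed.

Lemma bounded_on_extM : exists2 C, 0 < C & forall x, M x -> `|u x| <= C.
Proof.
have cu : compact (u @` closure (M `&` [set x | u x != 0])).
  apply: continuous_compact => //; apply: continuous_in_subspaceT => x.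
  rewrite inE => Kx; apply/ucont/MU; have /closure_id -> := @closed_extM R.
  by apply: closureS Kx => y [].
have [C C0 bC] := ex_strict_bound_gt0 (compact_bounded cu).
exists C => // x Mx; have [->|ux] := eqVneq (u x) 0.
  by rewrite normr0 ltW.
by apply/ltW/bC; exists x => //; apply: subset_closure.
Qed.

(** This is the absolute value of the derivative of u^4 along [e]. The power 4 is the one for which
    three square roots of it multiply to u^6. *)
Let dens (e : pt3) (x : pt3) : R := 4 * `|u x| ^+ 3 * `|'D_e u x|.

(* The hypothesis on squares says that [M] is left only towards [t = 0], so that
   the half-line from [s] pointing away from [0] stays in [M]. *)
Lemma expr4_le_integral_line (g : R -> pt3) (e : pt3) (K s : R) :
  (forall h t, g (h + t) = h *: e + g t) ->
  continuous g -> measurable_fun setT g ->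
  (forall x, U x -> {for x, continuous ('D_e u)}) ->
  measurable_fun M (dens e) ->
  (forall t t', t ^+ 2 <= t' ^+ 2 -> M (g t) -> M (g t')) ->
  (forall t, M (g t) -> u (g t) != 0 -> `|t| <= K) ->
  M (g s) ->
  ((u (g s) ^+ 4)%:E <= \int[leb]_t ((EFin \o dens e) \_ M) (g t))%E.
Proof.
move=> ge cg mg cD mdens outw bK Ms.
have half (a b : R) : a <= b ->
    (forall t, a <= t <= b -> M (g t)) ->
    (`|u (g b) ^+ 4 - u (g a) ^+ 4|%:E
      <= \int[leb]_t ((EFin \o dens e) \_ M) (g t))%E.
  move=> ab abM.
  have Ug t : a <= t <= b -> U (g t) by move=> tab; apply/MU/abM.
  pose f' t := 4 * u (g t) ^+ 3 * 'D_e u (g t).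
  have := @dist_le_integral_derive R (fun t => u (g t) ^+ 4) f' a b ab.
  move=> /(_ _ _)/le_trans; apply.
  - move=> t tab; have du : is_derive t (1 : R) (u \o g) ('D_e u (g t)).
      by apply: is_derive_line => //; apply/diff_derivable/uder/Ug.
    exact: (is_deriveX 4 du).
  - move=> t tab.
    have cu : {for t, continuous (u \o g)}.
      by apply: continuous_comp; [exact: cg|apply/ucont/Ug].
    have cDu : {for t, continuous ('D_e u \o g)}.
      by apply: continuous_comp; [exact: cg|apply/cD/Ug].
    rewrite /f'; apply: cvgM => //; apply: cvgM; first exact: cvg_cst.
    by rewrite !exprS expr0 mulr1; apply: cvgM => //; apply: cvgM.
  - have mr : measurable_fun setT (fun t => ((EFin \o dens e) \_ M) (g t)).
      have mr : measurable_fun setT ((EFin \o dens e) \_ M).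
        apply: (measurable_restrictT _ (@measurable_extM R)).1.
        exact/measurable_EFinP.
      exact: (measurableT_comp mr mg).
    apply: (@le_trans _ _ (\int[leb]_(t in `[a, b]) ((EFin \o dens e) \_ M) (g t))%E).
      rewrite le_eqVlt; apply/orP; left; apply/eqP; apply: eq_integral => t.
      rewrite inE/= in_itv/= => /abM Mt.
      by rewrite patchE mem_set//= /f' /dens normrM normrM normrX (ger0_norm (ler0n _ 4)).
    apply: ge0_subset_integral => //.
    by move=> t _; rewrite patchE; case: ifP => // _; rewrite lee_fin !mulr_ge0.
have K1 : K < `|K| + 1 by rewrite (le_lt_trans (ler_norm K))// ltrDl.
have uz t : M (g t) -> K < `|t| -> u (g t) = 0.
  by move=> Mt Kt; apply/eqP; apply: contraTT Kt => /(bK t Mt); rewrite -leNgt.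
have fs : u (g s) ^+ 4 = `|u (g s) ^+ 4| by rewrite ger0_norm// exprn_even_ge0.
have [s0|s0] := leP 0 s.
  (* The far endpoint lies beyond the support, so [u (g b)] vanishes and the variation of u^4 on the
     segment is u^4 at [g s]; the maximum keeps [b] to the right of [s]. *)
  pose b := Num.max s (`|K| + 1).
  have sb : s <= b by rewrite le_max lexx.
  have Mt t : s <= t <= b -> M (g t).
    by move=> /andP[st _]; apply: outw Ms; rewrite ler_sqr ?nnegrE// (le_trans s0).
  have := half s b sb Mt; rewrite (uz b) ?expr0n/= ?sub0r ?normrN -?fs//.
    by apply: Mt; rewrite sb lexx.
  by rewrite (lt_le_trans K1)// (le_trans _ (ler_norm _))// le_max lexx orbT.
pose b := Num.min s (- (`|K| + 1)).
have bs : b <= s by rewrite ge_min lexx.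
have Mt t : b <= t <= s -> M (g t).
  move=> /andP[_ ts]; apply: outw Ms; rewrite -(sqrrN s) -(sqrrN t).
  by rewrite ler_sqr ?nnegrE ?oppr_ge0 ?lerN2 ?(ltW (le_lt_trans ts s0))// ltW.
have := half b s bs Mt; rewrite (uz b) ?expr0n/= ?subr0 -?fs//.
  by apply: Mt; rewrite bs lexx.
rewrite -normrN (lt_le_trans K1)// (le_trans _ (ler_norm _))//.
by rewrite lerNr ge_min lexx orbT.
Qed.

Local Notation leb3 := ((leb \x leb) \x leb)%E.

Let half_neq0 : 2^-1 != 0 :> R. Proof. by rewrite invr_neq0// pnatr_eq0. Qed.

Let measurable_u : measurable_fun M u.
Proof.
by apply: continuous_measurable_pt3 MU ucont => //;
  [case: uC1|exact: measurable_extM].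
Qed.

Let measurable_D e : (forall x, U x -> {for x, continuous ('D_e u)}) ->
  measurable_fun M ('D_e u).
Proof.
by apply: continuous_measurable_pt3 MU => //;
  [case: uC1|exact: measurable_extM].
Qed.

Let measurable_dens e : (forall x, U x -> {for x, continuous ('D_e u)}) ->
  measurable_fun M (dens e).
Proof.
move=> cD; apply: measurable_funM; last first.
  by apply: measurableT_comp => //; exact: measurable_D.
apply: measurable_funM; first exact: measurable_cst.
by apply: measurable_funX; exact: measurableT_comp.
Qed.

Let X := (\int[leb3]_(x in M) (`|u x| ^+ 6)%:E)%E.
Let Y e := (\int[leb3]_(x in M) ('D_e u x ^+ 2)%:E)%E.

(** [X] will occur on both sides of the inequality to be solved, and cancelling it requires
    finiteness. The integrand is bounded by [C ^+ 6] and vanishes outside a cube. *)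
Lemma integral_expr6_lty : (X < +oo)%E.
Proof.
have [K K0 bK] := support_bounded; have [C C0 bC] := bounded_on_extM.
pose I := `[(- K : R), K]%classic; pose B := (I `*` I) `*` I.
have mI : measurable I by exact: measurable_itv.
have mB : measurable B by apply: measurableX => //; exact: measurableX.
have mX : measurable_fun M (fun x => (`|u x| ^+ 6)%:E).
  by apply/measurable_EFinP/measurable_funX; exact: measurableT_comp.
apply: (@le_lt_trans _ _ (\int[leb3]_(x in B) (C ^+ 6)%:E)%E); last first.
  rewrite integral_cst// [X in (_ * X)%E](_ : _ = (leb I * leb I) * leb I)%E.
    rewrite lebesgue_measure_itv/=; case: ifP => _.
      by rewrite -EFinB -!EFinM ltry.
    by rewrite -!EFinM ltry.
  transitivity ((leb \x leb) (I `*` I) * leb I)%E.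
    by apply: product_measure1E => //; exact: measurableX.
  by congr (_ * _)%E; exact: product_measure1E.
rewrite /X integral_mkcond [leRHS]integral_mkcond.
apply: ge0_le_integral => //.
- by move=> x _; rewrite patchE; case: ifP => // _; rewrite lee_fin exprn_ge0.
- exact: (measurable_restrictT _ (@measurable_extM R)).1.
- by apply: (measurable_restrictT _ mB).1; exact: measurable_cst.
move=> x _; rewrite !patchE; case: ifPn => [/set_mem Mx|_]; last first.
  by case: ifP => // _; rewrite lee_fin/= exprn_ge0// ltW.
have [u0|u0] := eqVneq (u x) 0.
  by rewrite u0 normr0 exprS mul0r; case: ifP => // _;
    rewrite lee_fin/= exprn_ge0// ltW.
rewrite mem_set ?lee_fin ?lerXn2r ?nnegrE ?bC ?(ltW C0)//.
have [h1 h2 h3] := bK x Mx u0.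
by split; [split|]; rewrite /I/= in_itv/= -ler_norml.
Qed.

(** Cauchy-Schwarz with |u|^3 as the square root of |u|^6: the power 6 to be estimated reappears on
    the right, which makes the final inequality self-improving. *)
Lemma integral_dens_le e : (forall x, U x -> {for x, continuous ('D_e u)}) ->
  (\int[leb3]_x ((EFin \o dens e) \_ M) x <= 4%:E * (X `^ 2^-1 * Y e `^ 2^-1))%E.
Proof.
move=> cD.
pose f := (fun x : pt3 => (`|u x| ^+ 6)%:E) \_ M.
pose g := (fun x : pt3 => ('D_e u x ^+ 2)%:E) \_ M.
have mf : measurable_fun setT f.
  apply: (measurable_restrictT _ (@measurable_extM R)).1.
  by apply/measurable_EFinP/measurable_funX; exact: measurableT_comp.
have mg : measurable_fun setT g.
  apply: (measurable_restrictT _ (@measurable_extM R)).1.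
  by apply/measurable_EFinP/measurable_funX; exact: measurable_D.
have f0 x : (0 <= f x)%E.
  by rewrite /f patchE; case: ifP => // _; rewrite lee_fin exprn_ge0.
have g0 x : (0 <= g x)%E.
  by rewrite /g patchE; case: ifP => // _; rewrite lee_fin sqr_ge0.
have -> : X = (\int[leb3]_x f x)%E by rewrite /X integral_mkcond.
have -> : Y e = (\int[leb3]_x g x)%E by rewrite /Y integral_mkcond.
apply: (@le_trans _ _
    (4%:E * \int[leb3]_x (f x `^ 2^-1 * g x `^ 2^-1))%E); last first.
  by rewrite lee_wpmul2l ?lee_fin// integral_sqrt_mul_le.
rewrite -ge0_integralZl//; last 2 first.
- by apply: emeasurable_funM; apply: (measurableT_comp (measurable_poweR _)).
- by move=> x _; rewrite mule_ge0// poweR_ge0.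
rewrite le_eqVlt; apply/orP; left; apply/eqP; apply: eq_integral => x _.
rewrite /f /g !patchE; case: ifP => _; last by rewrite !poweR0r// !mule0.
rewrite !poweR_EFin !powR12_sqrt ?sqr_ge0 ?exprn_ge0//.
rewrite -[6%N]/(3 * 2)%N exprM !sqrtr_sqr normrX normr_id /dens/=.
by rewrite -!EFinM mulrA.
Qed.

(** Write u^6 as a product of three factors u^2. Each is at most the square root of the integral of
    [dens] along one coordinate line, a function of the other two coordinates only, which is the
    situation of [loomis_whitney]. *)
Lemma gagliardo_nirenberg_extM :
  (X <= (4%:E * (X `^ 2^-1 * Y (e1 R) `^ 2^-1)) `^ 2^-1
      * (4%:E * (X `^ 2^-1 * Y (e2 R) `^ 2^-1)) `^ 2^-1
      * (4%:E * (X `^ 2^-1 * Y (e3 R) `^ 2^-1)) `^ 2^-1)%E.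
Proof.
have [_ [_ [cD1 [cD2 cD3]]]] := uC1.
have [K K0 bK] := support_bounded.
(* Extension by zero lets the integrals run over full lines, so that Loomis-Whitney applies on a
   product space although [M] is not a product. *)
pose G e := (EFin \o dens e) \_ M.
have G0 e x : (0 <= G e x)%E.
  by rewrite /G patchE; case: ifP => // _; rewrite lee_fin !mulr_ge0.
have mG e : (forall x, U x -> {for x, continuous ('D_e u)}) ->
    measurable_fun setT (G e).
  move=> cD; apply: (measurable_restrictT _ (@measurable_extM R)).1.
  by apply/measurable_EFinP; exact: measurable_dens.
pose F1 p := (\int[leb]_t G (e1 R) ((t, p.1), p.2))%E.
pose F2 p := (\int[leb]_t G (e2 R) ((p.1, t), p.2))%E.
pose F3 p := (\int[leb]_t G (e3 R) (p, t))%E.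
have mF1 : measurable_fun setT F1 by apply: measurable_int_fst => //; exact: mG.
have mF2 : measurable_fun setT F2 by apply: measurable_int_snd => //; exact: mG.
have mF3 : measurable_fun setT F3 by apply: measurable_int_trd => //; exact: mG.
have F10 p : (0 <= F1 p)%E by exact: integral_ge0.
have F20 p : (0 <= F2 p)%E by exact: integral_ge0.
have F30 p : (0 <= F3 p)%E by exact: integral_ge0.
have half_ge0 : 0 <= 2^-1 :> R by rewrite invr_ge0 ler0n.
have le_rt (x y : \bar R) : (0 <= x -> x <= y -> x `^ 2^-1 <= y `^ 2^-1)%E.
  move=> x0 xy; apply: gt0_ler_poweR => //.
    by rewrite in_itv/= x0 leey.
  by rewrite in_itv/= (le_trans x0 xy) leey.
have outw (a b c : R) (a' b' c' : R) :
    a ^+ 2 + b ^+ 2 + c ^+ 2 <= a' ^+ 2 + b' ^+ 2 + c' ^+ 2 ->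
    M (a, b, c) -> M (a', b', c').
  by move=> le /extM_sqr/= h; apply/extM_sqr; exact: le_trans le.
have key x : M x -> [/\ ((u x ^+ 4)%:E <= F1 (x.1.2, x.2))%E,
    ((u x ^+ 4)%:E <= F2 (x.1.1, x.2))%E & ((u x ^+ 4)%:E <= F3 x.1)%E].
  case: x => [[a b] c] Mx; split.
  - apply: (@expr4_le_integral_line (fun t => (t, b, c)) (e1 R) K a) => //.
    + by move=> h t; exact: line_fst.
    + by apply: continuous_pair; [apply: continuous_pair|] => ?;
        [exact: cvg_id|exact: cvg_cst..].
    + by apply: measurable_fun_pair => //; exact: measurable_fun_pair.
    + exact: measurable_dens.
    + by move=> t t' tt'; apply: outw; rewrite !lerD2r.
    + by move=> t Mt ut; have [] := bK _ Mt ut.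
  - apply: (@expr4_le_integral_line (fun t => (a, t, c)) (e2 R) K b) => //.
    + by move=> h t; exact: line_snd.
    + by apply: continuous_pair; [apply: continuous_pair|] => ?;
        [exact: cvg_cst|exact: cvg_id|exact: cvg_cst].
    + by apply: measurable_fun_pair => //; exact: measurable_fun_pair.
    + exact: measurable_dens.
    + by move=> t t' tt'; apply: outw; rewrite lerD2r lerD2l.
    + by move=> t Mt ut; have [] := bK _ Mt ut.
  - apply: (@expr4_le_integral_line (fun t => (a, b, t)) (e3 R) K c) => //.
    + by move=> h t; exact: line_trd.
    + by apply: continuous_pair; [apply: continuous_pair|] => ?;
        [exact: cvg_cst|exact: cvg_cst|exact: cvg_id].
    + by apply: measurable_fun_pair => //; exact: measurable_fun_pair.
    + exact: measurable_dens.
    + by move=> t t' tt'; apply: outw; rewrite lerD2l.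
    + by move=> t Mt ut; have [] := bK _ Mt ut.
apply: (@le_trans _ _ (\int[leb3]_x
    (F1 (x.1.2, x.2) `^ 2^-1 * F2 (x.1.1, x.2) `^ 2^-1 * F3 x.1 `^ 2^-1))%E).
  rewrite /X integral_mkcond; apply: ge0_le_integral => //.
  - by move=> x _; rewrite patchE; case: ifP => // _; rewrite lee_fin exprn_ge0.
  - apply: (measurable_restrictT _ (@measurable_extM R)).1.
    by apply/measurable_EFinP/measurable_funX; exact: measurableT_comp.
  - apply: emeasurable_funM; [apply: emeasurable_funM|];
      apply: (measurableT_comp (measurable_poweR _)).
    + apply: (measurableT_comp mF1); apply: measurable_fun_pair;
        [exact: (measurableT_comp measurable_snd measurable_fst)|exact: measurable_snd].
    + apply: (measurableT_comp mF2); apply: measurable_fun_pair;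
        [exact: (measurableT_comp measurable_fst measurable_fst)|exact: measurable_snd].
    + exact: (measurableT_comp mF3 measurable_fst).
  - move=> x _; rewrite patchE; case: ifPn => [/set_mem Mx|_]; last first.
      by rewrite !mule_ge0 ?poweR_ge0.
    have [h1 h2 h3] := key x Mx.
    have rt4 : ((u x ^+ 2)%:E = (u x ^+ 4)%:E `^ 2^-1)%E.
      rewrite poweR_EFin powR12_sqrt ?exprn_even_ge0// -[4%N]/(2 * 2)%N exprM.
      by rewrite sqrtr_sqr ger0_norm ?sqr_ge0.
    have -> : ((`|u x| ^+ 6)%:E
        = (u x ^+ 2)%:E * (u x ^+ 2)%:E * (u x ^+ 2)%:E)%E.
      by rewrite -!EFinM -!exprD -normrX ger0_norm ?exprn_even_ge0.
    have u40 : (0 <= (u x ^+ 4)%:E)%E by rewrite lee_fin exprn_even_ge0.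
    have le_rt4 V : ((u x ^+ 4)%:E <= V -> (u x ^+ 2)%:E <= V `^ 2^-1)%E.
      by move=> le4; rewrite rt4; exact: le_rt.
    have u20 : (0 <= (u x ^+ 2)%:E)%E by rewrite lee_fin sqr_ge0.
    apply: (lee_pmul (mule_ge0 u20 u20) u20 _ (le_rt4 _ h3)).
    exact: (lee_pmul u20 u20 (le_rt4 _ h1) (le_rt4 _ h2)).
apply: le_trans (loomis_whitney leb leb leb mF1 mF2 mF3 F10 F20 F30) _.
have fact e V : (forall x, U x -> {for x, continuous ('D_e u)}) ->
    (\int[leb3]_x G e x = V)%E ->
    (V `^ 2^-1 <= (4%:E * (X `^ 2^-1 * Y e `^ 2^-1)) `^ 2^-1)%E.
  by move=> cD <-; apply: le_rt; [exact: integral_ge0|exact: integral_dens_le].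
have E1 : (\int[leb3]_x G (e1 R) x = \int[leb \x leb]_p F1 p)%E.
  exact: (tonelli_fst leb leb leb (mG _ cD1) (G0 _)).
have E2 : (\int[leb3]_x G (e2 R) x = \int[leb \x leb]_p F2 p)%E.
  exact: (tonelli_snd leb leb leb (mG _ cD2) (G0 _)).
have E3 : (\int[leb3]_x G (e3 R) x = \int[leb \x leb]_p F3 p)%E.
  exact: (tonelli_trd leb leb leb (mG _ cD3) (G0 _)).
apply: (lee_pmul _ (poweR_ge0 _ _) _ (fact _ _ cD3 E3)).
  by apply: mule_ge0; exact: poweR_ge0.
exact: (lee_pmul (poweR_ge0 _ _) (poweR_ge0 _ _) (fact _ _ cD1 E1) (fact _ _ cD2 E2)).
Qed.

End ExteriorGN.

(** * The test function bounding the Sobolev constant from below *)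

Section Test1D.
Context (R : realType).

(** Used for [pos ^+ 2], whose first-order Taylor error is at most [h ^+ 2] everywhere; the kink of
    [pos] at 0 then needs no separate limit. *)
Lemma is_derive_quadratic_bound (g : R -> R) (s d : R) :
  (forall h, `|g (h + s) - g s - d * h| <= h ^+ 2) -> is_derive s 1 g d.
Proof.
move=> gb.
have cv : (fun h : R => h^-1 *: ((g \o shift s) (h *: (1 : R)) - g s)) @ 0^' --> d.
  apply/cvgrPdist_le => e e0; near=> h.
  have h0 : h != 0 by near: h; exact: nbhs_dnbhs_neq.
  have he : `|h| <= e.
    near: h; apply: (@dnbhs0_le R R) => //.
  rewrite /= /shift/= /GRing.scale/= mulr1 distrC.
  have -> : h^-1 * (g (h + s) - g s) - d = h^-1 * (g (h + s) - g s - d * h).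
    by field.
  rewrite normrM normfV ler_pdivrMl ?normr_gt0//.
  apply: le_trans (gb h) _; rewrite -(ger0_norm (sqr_ge0 h)) expr2 normrM.
  by rewrite ler_wpM2l.
split; first by apply/cvg_ex; exists d.
exact: cvg_lim cv.
Unshelve. all: by end_near. Qed.

Definition pos (s : R) : R := Num.max s 0.

Lemma pos_ge0 s : 0 <= pos s. Proof. by rewrite le_max lexx orbT. Qed.

Lemma is_derive_pos_sqr (s : R) : is_derive s 1 (fun t => pos t ^+ 2) (2 * pos s).
Proof.
apply: is_derive_quadratic_bound => h; rewrite ler_norml /pos.
by case: (leP (h + s) 0) => h1; case: (leP s 0) => h2; apply/andP; split; nra.
Qed.

Lemma continuous_pos : continuous pos.
Proof.
move=> t; apply: continuous_max; [exact: cvg_id|exact: cvg_cst].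
Qed.

Lemma pos_in (t : R) : -1 <= t <= 1 -> pos (1 - t ^+ 2) = 1 - t ^+ 2.
Proof. by move=> /andP[h1 h2]; apply/max_idPl; nra. Qed.

Lemma pos_out (t : R) : ~~ (-1 <= t <= 1) -> pos (1 - t ^+ 2) = 0.
Proof.
by rewrite negb_and -!ltNge => /orP h; apply/max_idPr; case: h => h; nra.
Qed.

Lemma is_derive_1Bsqr (t : R) : is_derive t 1 (fun t : R => 1 - t ^+ 2) (- (2 * t)).
Proof.
have := is_deriveB (is_derive_cst (1 : R) t 1) (is_deriveX 2 (is_derive_id t 1)).
by rewrite (_ : 0 - _ = - (2 * t))// sub0r /GRing.scale/= mulr1 expr1.
Qed.

(* An even exponent makes [poly_bump] a power of the C^1 function [pos ^+ 2];
   the exponent 4 would give too weak a lower bound on [A]. *)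
Definition poly_bump (t : R) : R := pos (1 - t ^+ 2) ^+ 6.

Lemma poly_bump_ge0 t : 0 <= poly_bump t.
Proof. by rewrite exprn_ge0 ?pos_ge0. Qed.

Lemma poly_bump_neq0 t : poly_bump t != 0 -> -1 <= t <= 1.
Proof. by apply: contraNT => t1; rewrite /poly_bump pos_out// expr0n. Qed.

Definition poly_bump' (t : R) : R := - (12 * t * pos (1 - t ^+ 2) ^+ 5).

Lemma is_derive_poly_bump (t : R) : is_derive t 1 poly_bump (poly_bump' t).
Proof.
have d1 := is_derive_1Bsqr t.
have d2 := @is_derive1_comp R (fun s => pos s ^+ 2) _ t _ _ (is_derive_pos_sqr _) d1.
have := is_deriveX 3 d2.
have -> : ((fun s : R => pos s ^+ 2) \o (fun t0 : R => 1 - t0 ^+ 2)) ^+ 3 = poly_bump.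
  by apply/funext => x; rewrite /poly_bump -[6%N]/(2 * 3)%N exprM.
rewrite (_ : _ *: _ = poly_bump' t)// /poly_bump' /GRing.scale/=.
ring.
Qed.

Lemma continuous_poly_bump' : continuous poly_bump'.
Proof.
move=> t; apply: cvgN; apply: cvgM; first by apply: cvgM; [exact: cvg_cst|exact: cvg_id].
have cp : {for t, continuous (fun t : R => pos (1 - t ^+ 2))}.
  apply: (@continuous_comp _ _ _ (fun t : R => 1 - t ^+ 2) pos); last exact: continuous_pos.
  by apply: cvgB; [exact: cvg_cst|exact: exprn_continuous].
apply: (@continuous_comp _ _ _ (fun t : R => pos (1 - t ^+ 2)) (fun s => s ^+ 5)) => //.
exact: exprn_continuous.
Qed.

End Test1D.

Section Wallis.
Context (R : realType).
Local Notation leb := (@lebesgue_measure R).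

(* [wallis n] is the integral of [(1 - t ^+ 2) ^+ n] over [[-1, 1]], and
   [wallis_prim n] an antiderivative of the integrand; the recursion comes from
   the derivative of [t * (1 - t ^+ 2) ^+ n.+1]. *)
Fixpoint wallis_prim (n : nat) (t : R) : R :=
  if n is m.+1 then
    (t * (1 - t ^+ 2) ^+ m.+1 + (2 * m.+1)%:R * wallis_prim m t) / (2 * m.+1).+1%:R
  else t.

Fixpoint wallis (n : nat) : R :=
  if n is m.+1 then (2 * m.+1)%:R / (2 * m.+1).+1%:R * wallis m else 2.

Lemma is_derive_wallis_prim n (t : R) :
  is_derive t 1 (wallis_prim n) ((1 - t ^+ 2) ^+ n).
Proof.
elim: n => [|n IH]; first by rewrite expr0; exact: is_derive_id.
have d1 := is_derive_1Bsqr t.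
have d2 := is_deriveM (is_derive_id t 1) (is_deriveX n.+1 d1).
have d3 := is_deriveD d2 (is_deriveZ (2 * n.+1)%:R IH).
have -> : wallis_prim n.+1 = (2 * n.+1).+1%:R^-1 \*: (id * (fun t : R => 1 - t ^+ 2) ^+ n.+1
    + (2 * n.+1)%:R \*: wallis_prim n).
  apply/funext => x; rewrite [RHS]mulrC /=; congr ((_ + _) / _).
  by congr (_ * _); rewrite fctE.
apply: is_derive_eq (is_deriveZ ((2 * n.+1).+1%:R^-1) d3) _.
rewrite /GRing.scale/=.
have n0 : (2 * n.+1).+1%:R != 0 :> R by rewrite pnatr_eq0.
apply: (mulfI n0); rewrite mulVKf// -[(2 * n.+1).+1]addn1 natrD natrM.
by rewrite fctE /= (exprS _ n); ring.
Qed.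

(** The boundary term [t * (1 - t ^+ 2) ^+ m.+1] vanishes at both endpoints, so only the recursive
    term survives. *)
Lemma wallis_prim_sub n : wallis_prim n 1 - wallis_prim n (- 1) = wallis n.
Proof.
elim: n => [|n IH] /=; first by rewrite opprK.
by rewrite sqrrN expr1n subrr !exprS !mul0r !mulr0 !add0r -mulrBl -mulrBr IH mulrAC.
Qed.

(** In the applications [w] is only piecewise polynomial, while [q] is the polynomial it equals on
    [-1, 1]; the fundamental theorem is applied to [q], which is smooth across the endpoints. *)
Lemma integral_supported_itv (q Q w : R -> R) :
  (forall t : R, is_derive t 1 Q (q t)) -> continuous q ->
  (forall t : R, -1 <= t <= 1 -> w t = q t) ->
  (forall t : R, ~~ (-1 <= t <= 1) -> w t = 0) ->
  (\int[leb]_t (w t)%:E = (Q 1 - Q (-1))%R%:E)%E.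
Proof.
move=> dQ cq wq w0.
have cQ : continuous Q.
  move=> t; apply: differentiable_continuous; apply/derivable1_diffP.
  by have [] := dQ t.
have -> : (\int[leb]_t (w t)%:E = \int[leb]_(t in `[(-1)%R, 1%R]) (q t)%:E)%E.
  rewrite [RHS]integral_mkcond; apply: eq_integral => t _; rewrite patchE.
  case: ifPn => [|/negP tI].
    by rewrite inE/= in_itv/= => /wq ->.
  by rewrite w0//; apply/negP => h; apply: tI; rewrite inE/= in_itv.
have lt11 : (-1 : R) < 1 by lra.
rewrite (continuous_FTC2 lt11 (F := Q)) ?EFinB//.
- exact: continuous_subspaceT.
- split.
  + by move=> t _; have [] := dQ t.
  + exact: cvg_at_right_filter (cQ _).
  + exact: cvg_at_left_filter (cQ _).
- by move=> t _; rewrite derive1E; have [] := dQ t.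
Qed.

Let cpoly n : continuous (fun t : R => (1 - t ^+ 2) ^+ n).
Proof.
move=> t; apply: (@continuous_comp _ _ _ (fun t : R => 1 - t ^+ 2) (fun s => s ^+ n)).
  by apply: cvgB; [exact: cvg_cst|exact: exprn_continuous].
exact: exprn_continuous.
Qed.

(** The exponent is positive because the power 0 would be 1 on the whole line. *)
Lemma integral_poly_bumpX n : (\int[leb]_t (poly_bump t ^+ n.+1)%:E = (wallis (6 * n.+1))%:E)%E.
Proof.
rewrite (@integral_supported_itv _ _ _ (is_derive_wallis_prim (6 * n.+1))
  (@cpoly (6 * n.+1))) ?wallis_prim_sub//.
- by move=> t h; rewrite /poly_bump pos_in// exprM.
- by move=> t h; rewrite /poly_bump pos_out// -exprM expr0n.
Qed.

(** On [-1, 1] the integrand is 144 t^2 (1 - t^2)^10, and t^2 = 1 - (1 - t^2) splits it into two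
    Wallis integrands. *)
Lemma integral_poly_bump'_sqr :
  (\int[leb]_t (poly_bump' t ^+ 2)%:E = (144 * (wallis 10 - wallis 11))%:E)%E.
Proof.
pose p k (t : R) := (1 - t ^+ 2) ^+ k.
have dp (t : R) : is_derive t 1 (144 \*: (wallis_prim 10 - wallis_prim 11))
    (144 *: (p 10 t - p 11 t)).
  by apply: is_deriveZ; apply: is_deriveB; exact: is_derive_wallis_prim.
have cp : continuous (fun t => 144 *: (p 10 t - p 11 t)).
  by move=> t; apply: cvgZr; apply: cvgB; exact: cpoly.
rewrite (integral_supported_itv dp cp).
- rewrite -!wallis_prim_sub; congr _%:E.
  rewrite -[(144 \*: _) 1]/(144 * (wallis_prim 10 1 - wallis_prim 11 1)).
  rewrite -[(144 \*: _) (-1)]/(144 * (wallis_prim 10 (-1) - wallis_prim 11 (-1))).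
  by ring.
- move=> t h; rewrite /poly_bump' pos_in//.
  rewrite -[RHS]/(144 * (p 10 t - p 11 t)) /p.
  ring.
- by move=> t h; rewrite /poly_bump' pos_out// expr0n/= mulr0 oppr0 expr0n.
Qed.

End Wallis.

Section ProjectionsDifferentiable.
Context (R : numFieldType) (V W : normedModType R).

Lemma differentiable_fst (p : V * W) : differentiable (@Datatypes.fst V W) p.
Proof.
have lin : linear (@Datatypes.fst V W) by [].
pose F : {linear (V * W)%type -> V} :=
  HB.pack (@Datatypes.fst V W) (GRing.isLinear.Build _ _ _ _ _ lin).
by apply: (@linear_differentiable _ _ _ F) => x; exact: cvg_fst.
Qed.

Lemma differentiable_snd (p : V * W) : differentiable (@Datatypes.snd V W) p.
Proof.
have lin : linear (@Datatypes.snd V W) by [].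
pose F : {linear (V * W)%type -> W} :=
  HB.pack (@Datatypes.snd V W) (GRing.isLinear.Build _ _ _ _ _ lin).
by apply: (@linear_differentiable _ _ _ F) => x; exact: cvg_snd.
Qed.

End ProjectionsDifferentiable.

Section TestFunction.
Context (R : realType).
Local Notation pt3 := (pt3 R).
Local Notation leb := (@lebesgue_measure R).
Local Notation leb3 := ((leb \x leb) \x leb)%E.
Local Notation f := (@poly_bump R).
Local Notation f' := (@poly_bump' R).

Lemma integral_prod3 (a b c : R -> R) :
  measurable_fun setT a -> measurable_fun setT b -> measurable_fun setT c ->
  (forall t, 0 <= a t) -> (forall t, 0 <= b t) -> (forall t, 0 <= c t) ->
  (\int[leb3]_x (a x.1.1 * b x.1.2 * c x.2)%:E =
   (\int[leb]_t (a t)%:E) * (\int[leb]_t (b t)%:E) * (\int[leb]_t (c t)%:E))%E.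
Proof.
move=> ma mb mc a0 b0 c0.
have I0 (g : R -> R) : (forall t, 0 <= g t) -> (0 <= \int[leb]_t (g t)%:E)%E.
  by move=> g0; apply: integral_ge0 => t _; rewrite lee_fin.
have mE (g : R -> R) : measurable_fun setT g -> measurable_fun setT (EFin \o g).
  by move=> mg; apply/measurable_EFinP.
rewrite (tonelli123 leb leb leb); last 2 first.
- apply/measurable_EFinP; apply: measurable_funM; first apply: measurable_funM.
  + apply: (measurableT_comp ma).
    exact: (measurableT_comp measurable_fst measurable_fst).
  + apply: (measurableT_comp mb).
    exact: (measurableT_comp measurable_snd measurable_fst).
  + exact: (measurableT_comp mc measurable_snd).
- by move=> x; rewrite lee_fin !mulr_ge0.
have scale (k : R) (g : R -> R) : 0 <= k -> measurable_fun setT g ->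
    (forall t, 0 <= g t) ->
    (\int[leb]_t (k * g t)%:E = k%:E * \int[leb]_t (g t)%:E)%E.
  move=> k0 mg g0; rewrite -ge0_integralZl//; first exact: mE.
  by move=> t _; rewrite lee_fin.
have Ic0 := I0 _ c0.
transitivity (\int[leb]_x \int[leb]_y
    ((a x * b y)%:E * \int[leb]_t (c t)%:E))%E.
  apply: eq_integral => x _; apply: eq_integral => y _.
  by rewrite -(scale (a x * b y) c) ?mulr_ge0.
transitivity (\int[leb]_x
    ((a x)%:E * (\int[leb]_t (b t)%:E * \int[leb]_t (c t)%:E)))%E.
  apply: eq_integral => x _; rewrite ge0_integralZr//.
  - by rewrite (scale (a x) b)// muleA.
  - by apply/measurable_EFinP; apply: measurable_funM.
  - by move=> t _; rewrite lee_fin mulr_ge0.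
rewrite ge0_integralZr ?muleA//.
- exact: mE.
- by move=> t _; rewrite lee_fin.
- by rewrite mule_ge0 ?I0.
Qed.

(** A tensor product rather than a radial bump: every integral then factors into one-dimensional
    Wallis integrals with rational values. *)
Definition test_fun (x : pt3) : R := f x.1.1 * f x.1.2 * f x.2.

Let fdiff t : differentiable f t.
Proof. by apply/derivable1_diffP; have [] := is_derive_poly_bump t. Qed.

Let fcont : continuous f.
Proof. by move=> t; exact: differentiable_continuous. Qed.

Lemma derive_test_fun1 x : 'D_(e1 R) test_fun x = f' x.1.1 * f x.1.2 * f x.2.
Proof.
case: x => [[a b] c].
rewrite -(derive_line test_fun a (fun h s => line_fst s b c h)).
have -> : test_fun \o (fun t => (t, b, c)) = (f b * f c) \*: f.
  by apply/funext => t; rewrite /test_fun/= /GRing.scale/=; ring.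
have [_ ->] := is_deriveZ (f b * f c) (is_derive_poly_bump a).
by rewrite /GRing.scale/=; ring.
Qed.

Lemma derive_test_fun2 x : 'D_(e2 R) test_fun x = f x.1.1 * f' x.1.2 * f x.2.
Proof.
case: x => [[a b] c].
rewrite -(derive_line test_fun b (fun h s => line_snd a s c h)).
have -> : test_fun \o (fun t => (a, t, c)) = (f a * f c) \*: f.
  by apply/funext => t; rewrite /test_fun/= /GRing.scale/=; ring.
have [_ ->] := is_deriveZ (f a * f c) (is_derive_poly_bump b).
by rewrite /GRing.scale/=; ring.
Qed.

Lemma derive_test_fun3 x : 'D_(e3 R) test_fun x = f x.1.1 * f x.1.2 * f' x.2.
Proof.
case: x => [[a b] c].
rewrite -(derive_line test_fun c (fun h s => line_trd a b s h)).
have -> : test_fun \o (fun t => (a, b, t)) = (f a * f b) \*: f.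
  by apply/funext => t; rewrite /test_fun/= /GRing.scale/=; ring.
have [_ ->] := is_deriveZ (f a * f b) (is_derive_poly_bump c).
by rewrite /GRing.scale/=; ring.
Qed.

Let continuous_prod3 (a b c : R -> R) :
  continuous a -> continuous b -> continuous c ->
  continuous (fun x : pt3 => a x.1.1 * b x.1.2 * c x.2).
Proof.
move=> ca cb cc x; apply: cvgM; first apply: cvgM.
- apply: (@continuous_comp _ _ _ (fun x : pt3 => x.1.1) a); last exact: ca.
  by apply: (@continuous_comp _ _ _ fst fst); exact: cvg_fst.
- apply: (@continuous_comp _ _ _ (fun x : pt3 => x.1.2) b); last exact: cb.
  by apply: (@continuous_comp _ _ _ fst snd); [exact: cvg_fst|exact: cvg_snd].
- by apply: (@continuous_comp _ _ _ snd c); [exact: cvg_snd|exact: cc].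
Qed.

Lemma C1c_test_fun : C1c_R3 test_fun.
Proof.
split; last first.
  pose I : set R := `[-1, 1]%classic.
  have cI : compact I by exact: segment_compact.
  have cB : compact ((I `*` I) `*` I) by do 2 apply: compact_setX => //.
  have clB : closed ((I `*` I) `*` I).
    by apply: compact_closed cB; exact: norm_hausdorff.
  apply: (subclosed_compact _ cB); first exact: closed_closure.
  rewrite [X in _ `<=` X]((closure_id _).1 clB); apply: closureS => x /=.
  rewrite /test_fun mulf_eq0 negb_or mulf_eq0 negb_or => /andP[/andP[h1 h2] h3].
  by split; [split|]; rewrite /I/= in_itv/=; exact: poly_bump_neq0.
split; first exact: openT.
split.
  move=> x _; apply: differentiableM; first apply: differentiableM.
  - apply: (@differentiable_comp _ _ _ _ (fun x : pt3 => x.1.1) f) => //.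
    by apply: (@differentiable_comp _ _ _ _ fst fst); exact: differentiable_fst.
  - apply: (@differentiable_comp _ _ _ _ (fun x : pt3 => x.1.2) f) => //.
    by apply: (@differentiable_comp _ _ _ _ fst snd);
      [exact: differentiable_fst|exact: differentiable_snd].
  - by apply: (@differentiable_comp _ _ _ _ snd f) => //; exact: differentiable_snd.
have cD e g : 'D_e test_fun =1 g -> continuous g -> continuous ('D_e test_fun).
  by move=> /funext ->.
split; [|split] => x _.
- apply: (cD _ _ derive_test_fun1); apply: continuous_prod3 => //.
  exact: continuous_poly_bump'.
- apply: (cD _ _ derive_test_fun2); apply: continuous_prod3 => //.
  exact: continuous_poly_bump'.
- apply: (cD _ _ derive_test_fun3); apply: continuous_prod3 => //.
  exact: continuous_poly_bump'.
Qed.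

Let W := wallis R.

Let Ibump := @integral_poly_bumpX R.

Let mf : measurable_fun setT f.
Proof. exact: continuous_measurable_fun. Qed.

Let mf' : measurable_fun setT f'.
Proof. by apply: continuous_measurable_fun; exact: continuous_poly_bump'. Qed.

Let f0 : forall t, 0 <= f t := @poly_bump_ge0 R.

Lemma integral_test_fun6 :
  (\int[leb3]_x (`|test_fun x| `^ 6)%:E = (W 36 ^+ 3)%:E)%E.
Proof.
transitivity (\int[leb3]_x (f x.1.1 ^+ 6 * f x.1.2 ^+ 6 * f x.2 ^+ 6)%:E)%E.
  apply: eq_integral => x _.
  have v0 : 0 <= test_fun x by apply: mulr_ge0 => //; exact: mulr_ge0.
  by rewrite ger0_norm// powR_mulrn// /test_fun !exprMn.
have mf6 : measurable_fun setT (fun t => f t ^+ 6) by exact: measurable_funX.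
have f60 t : 0 <= f t ^+ 6 by exact: exprn_ge0.
rewrite (integral_prod3 mf6 mf6 mf6 f60 f60 f60).
by rewrite !Ibump -!EFinM -expr2 -exprSr.
Qed.

(** By symmetry the three partial derivatives contribute equally, each with one integral of f'^2 and
    two integrals [W 12] of f^2. *)
Lemma integral_grad_test_fun :
  (\int[leb3]_x (`|gradnorm test_fun x| `^ 2)%:E
    = (3 * (144 * (W 10 - W 11)) * W 12 ^+ 2)%:E)%E.
Proof.
have m2 (a : R -> R) : measurable_fun setT a -> measurable_fun setT (fun t => a t ^+ 2).
  exact: measurable_funX.
have s0 (a : R -> R) t : 0 <= a t ^+ 2 by exact: sqr_ge0.
have mp (a b c : R -> R) : measurable_fun setT a -> measurable_fun setT b ->
    measurable_fun setT c ->
    measurable_fun setT (fun x : pt3 => (a x.1.1 ^+ 2 * b x.1.2 ^+ 2 * c x.2 ^+ 2)%:E).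
  move=> ma mb mc; apply/measurable_EFinP; apply: measurable_funM; first apply: measurable_funM.
  + apply: (measurableT_comp (m2 _ ma)).
    exact: (measurableT_comp measurable_fst measurable_fst).
  + apply: (measurableT_comp (m2 _ mb)).
    exact: (measurableT_comp measurable_snd measurable_fst).
  + exact: (measurableT_comp (m2 _ mc) measurable_snd).
have p0 (a b c : R -> R) (x : pt3) :
    (0 <= (a x.1.1 ^+ 2 * b x.1.2 ^+ 2 * c x.2 ^+ 2)%:E)%E.
  by rewrite lee_fin; exact: (mulr_ge0 (mulr_ge0 (sqr_ge0 _) (sqr_ge0 _)) (sqr_ge0 _)).
transitivity (\int[leb3]_x (
   (f' x.1.1 ^+ 2 * f x.1.2 ^+ 2 * f x.2 ^+ 2)%:E
 + ((f x.1.1 ^+ 2 * f' x.1.2 ^+ 2 * f x.2 ^+ 2)%:E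
 + (f x.1.1 ^+ 2 * f x.1.2 ^+ 2 * f' x.2 ^+ 2)%:E)))%E.
  apply: eq_integral => x _; rewrite /gradnorm powR_mulrn// -normrX sqr_sqrtr.
    rewrite derive_test_fun1 derive_test_fun2 derive_test_fun3.
    rewrite -!EFinD ger0_norm ?addr_ge0 ?sqr_ge0// !exprMn addrA//.
  by rewrite !addr_ge0 ?sqr_ge0.
have intD (F G : pt3 -> \bar R) :
    measurable_fun setT F -> measurable_fun setT G ->
    (forall x, 0 <= F x)%E -> (forall x, 0 <= G x)%E ->
    (\int[leb3]_x (F x + G x) = \int[leb3]_x F x + \int[leb3]_x G x)%E.
  by move=> mF mG F0 G0; exact: ge0_integralD.
have int3 (a b c : R -> R) : measurable_fun setT a -> measurable_fun setT b ->
    measurable_fun setT c ->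
    (\int[leb3]_x (a x.1.1 ^+ 2 * b x.1.2 ^+ 2 * c x.2 ^+ 2)%:E =
     (\int[leb]_t (a t ^+ 2)%:E) * (\int[leb]_t (b t ^+ 2)%:E)
       * (\int[leb]_t (c t ^+ 2)%:E))%E.
  move=> /m2 ma /m2 mb /m2 mc.
  exact: (integral_prod3 ma mb mc (s0 a) (s0 b) (s0 c)).
rewrite (intD _ _ (mp _ _ _ mf' mf mf)
  (emeasurable_funD (mp _ _ _ mf mf' mf) (mp _ _ _ mf mf mf')) (p0 f' f f)
  (fun x => adde_ge0 (p0 f f' f x) (p0 f f f' x))).
rewrite (intD _ _ (mp _ _ _ mf mf' mf) (mp _ _ _ mf mf mf') (p0 f f' f) (p0 f f f')).
rewrite (int3 _ _ _ mf' mf mf) (int3 _ _ _ mf mf' mf) (int3 _ _ _ mf mf mf').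
rewrite integral_poly_bump'_sqr !Ibump -!EFinM -!EFinD; congr _%:E.
by rewrite /W -[(6 * 2)%N]/12%N; ring.
Qed.

End TestFunction.

(** * Numerical estimates for the lower bound on [A] *)

Section Constants.
Context (R : realType).
Local Notation W := (wallis R).

(** Without denominators the recursion is linear in the values of [W], so [lra] can chain its
    instances. *)
Let wallisS n : (2 * n%:R + 3) * W n.+1 = (2 * n%:R + 2) * W n.
Proof.
have -> : 2 * n%:R + 3 = (2 * n.+1).+1%:R :> R.
  by rewrite -[(2 * n.+1).+1]addn1 natrD natrM -[n.+1]addn1 natrD; ring.
have -> : 2 * n%:R + 2 = (2 * n.+1)%:R :> R.
  by rewrite natrM -[n.+1]addn1 natrD; ring.
by rewrite /= -!mulrA mulrCA mulVKf// pnatr_eq0.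
Qed.

Lemma wallis_gt0 n : 0 < W n.
Proof. by elim: n => [//|n IH] /=; rewrite mulr_gt0// divr_gt0. Qed.

Lemma wallis_nincr n : W n.+1 <= W n.
Proof.
have n3 : 0 < 2 * n%:R + 3 :> R by rewrite ltr_wpDl// mulr_ge0.
by rewrite -(ler_pM2l n3) wallisS ler_pM2r ?wallis_gt0// lerD2l ler_nat.
Qed.

(** The left side is a multiple of the cube of [w = W 10] and the right side at least a multiple of
    [w], so an upper bound on [w] is enough; [cube_le] makes the comparison linear. The true values
    are about 0.5405 for [W 10] and 0.589 for [W 36 / W 12]. *)
Lemma wallis_bound :
  4 * (144 * (W 10 - W 11)) * W 12 ^+ 2 <= 233 / 20 * W 36.
Proof.
have cube_le (w c : R) : 0 < w -> w <= c -> w * w ^+ 2 <= w * c ^+ 2.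
  move=> w0 wc; have c0 : 0 <= c by exact: le_trans (ltW w0) wc.
  by rewrite ler_pM2l// lerXn2r// nnegrE ltW.
have W10_gt0 := wallis_gt0 10.
have W10 : W 10 <= 541 / 1000.
  have w0 : W 0 = 2 by [].
  move: (wallisS 0) (wallisS 1) (wallisS 2) (wallisS 3) (wallisS 4).
  move: (wallisS 5) (wallisS 6) (wallisS 7) (wallisS 8) (wallisS 9).
  lra.
have W11 : W 11 = 22 / 23 * W 10 by move: (wallisS 10); lra.
have W12 : W 12 = 24 / 25 * W 11 by move: (wallisS 11); lra.
have W36 : 587 / 1000 * W 12 <= W 36.
  have W12_gt0 := wallis_gt0 12.
  move: (wallisS 12) (wallisS 13) (wallisS 14) (wallisS 15) (wallisS 16).
  move: (wallisS 17) (wallisS 18) (wallisS 19) (wallisS 20) (wallisS 21).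
  move: (wallisS 22) (wallisS 23) (wallisS 24) (wallisS 25) (wallisS 26).
  move: (wallisS 27) (wallisS 28) (wallisS 29) (wallisS 30) (wallisS 31).
  move: (wallisS 32) (wallisS 33) (wallisS 34) (wallisS 35).
  lra.
move: W36; rewrite W12 W11; move: (W 36) (W 10) W10 W10_gt0 => L w w_le w_gt0 L_ge.
have := cube_le _ _ w_gt0 w_le; lra.
Qed.

Lemma sobolev_const_bound (A : R) :
  0 <= A -> W 36 <= A ^+ 2 * (3 * (144 * (W 10 - W 11)) * W 12 ^+ 2) ->
  16 / 3 <= (2 * (2 + Num.sqrt 2) * A) ^+ 2.
Proof.
move=> A0 WA; have WB := wallis_bound.
have s2 : Num.sqrt 2 ^+ 2 = 2 :> R by rewrite sqr_sqrtr.
have s0 : 0 <= Num.sqrt 2 :> R by exact: sqrtr_ge0.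
(* This rational bound turns [4 + 4 * Num.sqrt 2 + 2] into [6 + 113 / 20], which is the [233 / 20]
   of [wallis_bound]. *)
have s1 : 113 / 80 <= Num.sqrt 2 :> R by nra.
have W36 := wallis_gt0 36.
have h : 4 * W 36 <= A ^+ 2 * 3 * (233 / 20) * W 36.
  set J := 144 * _ in WA WB; set K := W 12 ^+ 2 in WA WB.
  have A2 : 0 <= A ^+ 2 by exact: sqr_ge0.
  nra.
rewrite ler_pM2r// in h.
have -> : (2 * (2 + Num.sqrt 2) * A) ^+ 2
    = 4 * (4 + 4 * Num.sqrt 2 + Num.sqrt 2 ^+ 2) * A ^+ 2 by ring.
rewrite s2; have A2 : 0 <= A ^+ 2 by exact: sqr_ge0.
nra.
Qed.

End Constants.

(** * Solving the self-bounding inequality and comparing the constants *)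

Section Conclusion.
Context (R : realType).
Local Notation leb := (@lebesgue_measure R).
Local Notation leb3 := ((leb \x leb) \x leb)%E.
Local Notation M := (@extM R).

(* Raising to the fourth power gives [x ^+ 4 <= 4096 * x ^+ 3 * a * b * c]; then
   AM-GM applies to [a * b * c]. *)
Lemma self_bound_expr3 (x a b c : R) : 0 <= x -> 0 <= a -> 0 <= b -> 0 <= c ->
  x <= Num.sqrt (4 * (Num.sqrt x * Num.sqrt a))
       * Num.sqrt (4 * (Num.sqrt x * Num.sqrt b))
       * Num.sqrt (4 * (Num.sqrt x * Num.sqrt c)) ->
  x <= (16 / 3 * (a + b + c)) ^+ 3.
Proof.
move=> x0 a0 b0 c0 H.
have [->|xn0] := eqVneq x 0; first by rewrite exprn_ge0// !(mulr_ge0, addr_ge0).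
have xgt0 : 0 < x by rewrite lt_neqAle eq_sym xn0.
have {H}H : x ^+ 4 <= x ^+ 3 * (4096 * (a * b * c)).
  have H2 : x ^+ 2 <= 64 * Num.sqrt x ^+ 3 * (Num.sqrt a * Num.sqrt b * Num.sqrt c).
    apply: le_trans (lerXn2r 2 _ _ H) _; rewrite ?nnegrE ?mulr_ge0 ?sqrtr_ge0//.
    rewrite !exprMn !sqr_sqrtr ?mulr_ge0 ?sqrtr_ge0// le_eqVlt.
    by apply/orP; left; apply/eqP; ring.
  have := lerXn2r 2 _ _ H2; rewrite !nnegrE ?sqr_ge0 => /(_ isT).
  rewrite !mulr_ge0 ?exprn_ge0 ?sqrtr_ge0// => /(_ isT); rewrite -exprM.
  move/le_trans; apply.
  have E (s p q r : R) : (64 * s ^+ 3 * (p * q * r)) ^+ 2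
      = (s ^+ 2) ^+ 3 * (4096 * (p ^+ 2 * q ^+ 2 * r ^+ 2)) by ring.
  by rewrite E !sqr_sqrtr.
have {H}H : x <= 4096 * (a * b * c) by rewrite exprSr ler_pM2l ?exprn_gt0 in H.
apply: le_trans H _.
have amgm : 27 * (a * b * c) <= (a + b + c) ^+ 3.
  (* The difference of the two sides is half of (a + b + c) ((a - b)^2 + (b - c)^2 + (a - c)^2) plus
     three times a (b - c)^2 + b (a - c)^2 + c (a - b)^2, a positive combination of these nine
     products. The constant then comes from 4096 / 27 = (16/3)^3. *)
  have := mulr_ge0 a0 (sqr_ge0 (b - c)); have := mulr_ge0 b0 (sqr_ge0 (a - c)).
  have := mulr_ge0 c0 (sqr_ge0 (a - b)); have := mulr_ge0 a0 (sqr_ge0 (a - b)).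
  have := mulr_ge0 a0 (sqr_ge0 (a - c)); have := mulr_ge0 b0 (sqr_ge0 (a - b)).
  have := mulr_ge0 b0 (sqr_ge0 (b - c)); have := mulr_ge0 c0 (sqr_ge0 (a - c)).
  have := mulr_ge0 c0 (sqr_ge0 (b - c)).
  nra.
by rewrite exprMn; lra.
Qed.

(** An infinite [Y] makes the right-hand side [+oo], because [c] is positive; finiteness of the
    gradient integrals thus need not be established. For real values the sixth powers are
    compared. *)
Lemma self_bound_poweR (X Y1 Y2 Y3 : \bar R) (c : R) :
  0 < c -> 16 / 3 <= c ^+ 2 ->
  (0 <= X)%E -> (0 <= Y1)%E -> (0 <= Y2)%E -> (0 <= Y3)%E -> (X < +oo)%E ->
  (X <= (4%:E * (X `^ 2^-1 * Y1 `^ 2^-1)) `^ 2^-1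
      * (4%:E * (X `^ 2^-1 * Y2 `^ 2^-1)) `^ 2^-1
      * (4%:E * (X `^ 2^-1 * Y3 `^ 2^-1)) `^ 2^-1)%E ->
  (X `^ 6^-1 <= c%:E * (Y1 + (Y2 + Y3)) `^ 2^-1)%E.
Proof.
move=> cgt0 c2 X0 Y10 Y20 Y30 Xoo GN; have c0 := ltW cgt0.
have half0 : 2^-1 != 0 :> R by rewrite invr_neq0// pnatr_eq0.
have oo : (X `^ 6^-1 <= c%:E * +oo `^ 2^-1)%E.
  by rewrite poweRyr// gt0_muley ?lte_fin// leey.
have neqNy (y : \bar R) : (0 <= y)%E -> y != -oo%E by case: y.
case: Y1 Y10 GN => [y1||] // Y10 GN; last by rewrite addye// neqNy// adde_ge0.
case: Y2 Y20 GN => [y2||] // Y20 GN; last by rewrite addye ?neqNy.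
case: Y3 Y30 GN => [y3||] // Y30 GN.
case: X X0 Xoo GN oo => [x||] // X0 _ GN _.
move: X0 Y10 Y20 Y30 GN; rewrite !lee_fin => x0 y10 y20 y30.
rewrite !powR12_sqrt ?mulr_ge0 ?sqrtr_ge0 ?addr_ge0//.
move=> /(self_bound_expr3 x0 y10 y20 y30) xle.
rewrite addrA.
set D := y1 + y2 + y3 in xle *.
have D0 : 0 <= D by rewrite !addr_ge0.
rewrite -(@ler_pXn2r _ 6)// ?nnegrE ?powR_ge0 ?mulr_ge0 ?sqrtr_ge0//.
rewrite -powR_mulrn ?powR_ge0// -powRrM mulVf ?pnatr_eq0// powRr1//.
apply: le_trans xle _.
have -> : (c * Num.sqrt D) ^+ 6 = (c ^+ 2 * Num.sqrt D ^+ 2) ^+ 3 by ring.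
by rewrite sqr_sqrtr// lerXn2r ?nnegrE ?mulr_ge0 ?sqr_ge0// ler_wpM2r.
Qed.

Lemma Lp_on_extM_le (u : pt3 R -> R) (c : R) : C1c_M u ->
  0 <= c -> 16 / 3 <= c ^+ 2 ->
  (Lp_on M 6 u <= c%:E * Lp_on M 2 (gradnorm u))%E.
Proof.
move=> [[U [MU uC1]] suppu] c0 c2.
have cgt0 : 0 < c.
  rewrite lt_neqAle c0 andbT eq_sym; apply/eqP => cz.
  by move: c2; rewrite cz expr0n/=; lra.
have Xoo := integral_expr6_lty MU uC1 suppu.
have GN := gagliardo_nirenberg_extM MU uC1 suppu.
have [oU [_ [cD1 [cD2 cD3]]]] := uC1.
rewrite /Lp_on /leb3.
have -> : (\int[leb3]_(x in M) (`|u x| `^ 6)%:E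
    = \int[leb3]_(x in M) (`|u x| ^+ 6)%:E)%E.
  by apply: eq_integral => x _; rewrite powR_mulrn.
have sq0 e x : (0 <= ('D_e u x ^+ 2)%:E)%E by rewrite lee_fin sqr_ge0.
have mY e : (forall x, U x -> {for x, continuous ('D_e u)}) ->
    measurable_fun M (fun x => ('D_e u x ^+ 2)%:E).
  move=> cD; apply/measurable_EFinP/measurable_funX.
  by apply: continuous_measurable_pt3 MU cD => //; exact: measurable_extM.
have -> : (\int[leb3]_(x in M) (`|gradnorm u x| `^ 2)%:E
    = \int[leb3]_(x in M) ('D_(e1 R) u x ^+ 2)%:E
    + (\int[leb3]_(x in M) ('D_(e2 R) u x ^+ 2)%:E
    + \int[leb3]_(x in M) ('D_(e3 R) u x ^+ 2)%:E))%E.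
  have mM := @measurable_extM R.
  transitivity (\int[leb3]_(x in M) (('D_(e1 R) u x ^+ 2)%:E
      + (('D_(e2 R) u x ^+ 2)%:E + ('D_(e3 R) u x ^+ 2)%:E)))%E.
    apply: eq_integral => x _.
    rewrite powR_mulrn// /gradnorm -normrX sqr_sqrtr ?addr_ge0 ?sqr_ge0//.
    by rewrite ger0_norm ?addr_ge0 ?sqr_ge0// -!EFinD addrA.
  rewrite (ge0_integralD leb3 mM)//.
  - by rewrite (ge0_integralD leb3 mM)//; exact: mY.
  - exact: mY.
  - by move=> x _; rewrite adde_ge0.
  - by apply: emeasurable_funD; exact: mY.
have X0 : (0 <= \int[leb3]_(x in M) (`|u x| ^+ 6)%:E)%E.
  by apply: integral_ge0 => x _; rewrite lee_fin exprn_ge0.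
have Y0 e : (0 <= \int[leb3]_(x in M) ('D_e u x ^+ 2)%:E)%E.
  by apply: integral_ge0 => x _; exact: sq0.
exact: (self_bound_poweR cgt0 c2 X0 (Y0 _) (Y0 _) (Y0 _) Xoo GN).
Qed.

(** The sign of [A] is not given in advance: the test function has a positive [L^6] norm, which
    forces [A * G] to the power one half to be positive. The sign is needed to square the inequality
    and to have a nonnegative constant on [M]. *)
Lemma sobolev_const_ge (A : R) :
  (Lp_on setT 6 (@test_fun R) <= A%:E * Lp_on setT 2 (gradnorm (@test_fun R)))%E ->
  0 <= A /\ 16 / 3 <= (2 * (2 + Num.sqrt 2) * A) ^+ 2.
Proof.
rewrite /Lp_on /leb3 integral_test_fun6 integral_grad_test_fun.
set G := 3 * _ * _.
have cube_powR (x : R) : 0 <= x -> (x ^+ 3) `^ 6^-1 = Num.sqrt x.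
  move=> x0; rewrite -(powR_mulrn 3 x0) -powRrM.
  by rewrite (_ : 3 * 6^-1 = 2^-1) ?powR12_sqrt//; field.
have L_ge0 := ltW (wallis_gt0 R 36).
rewrite !poweR_EFin -EFinM lee_fin (cube_powR _ L_ge0) => H.
have L0 : 0 < Num.sqrt (wallis R 36) by rewrite sqrtr_gt0 wallis_gt0.
have AG : 0 < A * G `^ 2^-1 by exact: lt_le_trans H.
have Ggt : 0 < G `^ 2^-1.
  rewrite lt_neqAle powR_ge0 andbT eq_sym; apply/eqP => Gz.
  by move: AG; rewrite Gz mulr0 ltxx.
have A0 : 0 <= A by apply: ltW; rewrite -(pmulr_lgt0 _ Ggt).
split=> //; apply: sobolev_const_bound => //.
have G0 : 0 <= G.
  apply: mulr_ge0; last exact: sqr_ge0.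
  by do 2?apply: mulr_ge0 => //; rewrite subr_ge0 wallis_nincr.
rewrite (powR12_sqrt G0) in H.
have := lerXn2r 2 _ _ H; rewrite !nnegrE sqrtr_ge0 => /(_ isT).
rewrite mulr_ge0 ?sqrtr_ge0// => /(_ isT).
by rewrite sqr_sqrtr// [(A * _) ^+ 2]exprMn sqr_sqrtr.
Qed.

End Conclusion.

Theorem theorem5p3 (R : realType) (A : R) :
  (forall v : pt3 R -> R, C1c_R3 v ->
     (Lp_on setT 6 v <= A%:E * Lp_on setT 2 (gradnorm v))%E) ->
  forall u : pt3 R -> R, C1c_M u ->
    (Lp_on (@extM R) 6 u
       <= (2 * (2 + Num.sqrt 2) * A)%:E * Lp_on (@extM R) 2 (gradnorm u))%E.
Proof.
move=> HA u uC; have [A0 c2] := sobolev_const_ge (HA _ (C1c_test_fun R)).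
by apply: Lp_on_extM_le => //; rewrite !mulr_ge0 ?addr_ge0 ?sqrtr_ge0.
Qed.
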